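(* For every graph $G$ on $n\geq 2$ vertices without open twins and without isolated vertices, we have $$\lceil \log_2 n\rceil \leq \gamma^{\rm OD}(G)\leq n-1.$$
   Context: Graphs are finite, simple and undirected. For a vertex $v$ of $G=(V,E)$, $N(v)=\{u\in V: uv\in E\}$ and $N[v]=N(v)\cup\{v\}$. Open twins are distinct vertices $u,v$ with $N(u)=N(v)$; an isolated vertex is a vertex $v$ with $N(v)=\emptyset$. An OD-code of $G$ is a set $C\subseteq V$ with $N[v]\cap C\neq\emptyset$ for all $v\in V$ and $N(u)\cap C\neq N(v)\cap C$ for all distinct $u,v\in V$. $\gamma^{\rm OD}(G)$ denotes the minimum cardinality of an OD-code of $G$. *)

(* Defs.v *)
From mathcomp Require Import all_boot.

Set Implicit Arguments.
Unset Strict Implicit.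
Unset Printing Implicit Defensive.

Record sgraph := SGraph {
  vertex :> finType;
  adj : rel vertex;
  adj_sym : symmetric adj;
  adj_irr : irreflexive adj
}.

Section ODCodes.

Variable G : sgraph.
Implicit Types (u v : G) (C : {set G}).

Definition open_nbh v : {set G} := [set u | adj u v].

Definition closed_nbh v : {set G} := v |: open_nbh v.

Definition open_twins u v : bool := (u != v) && (open_nbh u == open_nbh v).

Definition isolated v : bool := open_nbh v == set0.

Definition dominating C : bool := [forall v, closed_nbh v :&: C != set0].

Definition open_separating C : bool :=
  [forall u, forall v, (u != v) ==> (open_nbh u :&: C != open_nbh v :&: C)].

Definition OD_code C : bool := dominating C && open_separating C.

(* [arg min] is a minimum only if its default, here the whole vertex set, is
   an OD-code; by OD_code_setT this is so as soon as any OD-code exists.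
   Graphs without OD-codes get the junk value #|G|. *)
Definition OD_number : nat := #|[arg min_(C < [set: G] | OD_code C) #|C|]|.

Lemma OD_code_setT C : OD_code C -> OD_code [set: G].
Proof.
case/andP=> /forallP domC /forallP sepC; apply/andP; split.
  apply/forallP=> v; apply: contraNneq (domC v).
  by rewrite setIT => ->; rewrite set0I.
apply/forallP=> u; apply/forallP=> v; apply/implyP=> uDv.
apply: contraNneq (implyP (forallP (sepC u) v) uDv).
by rewrite !setIT => ->.
Qed.

Lemma OD_numberP C0 : OD_code C0 ->
  (exists2 C, OD_code C & #|C| = OD_number) /\
  (forall C, OD_code C -> OD_number <= #|C|).
Proof.
by move=> /OD_code_setT odT; rewrite /OD_number; case: arg_minnP => // C; split;
  first by exists C.
Qed.

End ODCodes.

(* Main.v *)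
Require Import Defs.
From mathcomp Require Import all_boot.

(** The lower bound counts the traces [N(v) :&: C], which are pairwise distinct
    subsets of [C].  For the upper bound, distinct sets [F i], [i] in a nonempty
    [A], are separated by at most [#|A| - 1] points: a new set can collide with
    at most one of the sets already separated, so one more point suffices.
    Hence some [C] missing a vertex [w] separates the open neighbourhoods, so
    [~: [set w]] does too, and it is dominating as no vertex is isolated. *)

Lemma trace_eqS (T : finType) (X Y C D : {set T}) :
  C \subset D -> X :&: D = Y :&: D -> X :&: C = Y :&: C.
Proof. by move=> /setIidPr <- eqXY; rewrite !setIA eqXY. Qed.

(** This is Bondy's theorem, by induction on the size of [A]; the truncated predecessor lets the
    induction start at the empty set. *)
Lemma separating_points (I T : finType) (F : I -> {set T}) (A : {set I}) :
  injective F ->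
  exists2 C : {set T}, #|C| <= #|A|.-1 & {in A &, injective (fun i => F i :&: C)}.
Proof.
move=> injF; have [m] := ubnP #|A|; elim: m A => // m IHm A leAm.
have [->|[a Aa]] := set_0Vmem A.
  by exists set0 => [|i j]; rewrite ?cards0 ?inE.
have cardA : #|A| = #|A :\ a|.+1 by rewrite (cardsD1 a) Aa.
have [|C leC injC] := IHm (A :\ a); first by rewrite -ltnS -cardA.
(* A superset of [C] still separates [A :\ a], so only collisions with [a] need checking. *)
have sepA (D : {set T}) : C \subset D ->
    {in A :\ a, forall b, F b :&: D <> F a :&: D} ->
  {in A &, injective (fun i => F i :&: D)}.
  move=> sCD sepa i j Ai Aj eqij.
  have [ia|nia] := eqVneq i a; have [ja|nja] := eqVneq j a.
  - by rewrite ia ja.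
  - by case: (sepa j); rewrite ?in_setD1 ?nja // -eqij ia.
  - by case: (sepa i); rewrite ?in_setD1 ?nia // eqij ja.
  - by apply: injC (trace_eqS _ _ _ _ _ sCD eqij); rewrite in_setD1 ?nia ?nja.
have [/exists_inP[b Bb /eqP eqba]|] :=
  boolP [exists b in A :\ a, F b :&: C == F a :&: C]; last first.
  move=> /exists_inPn sepa; exists C.
    by rewrite (leq_trans leC) // cardA leq_pred.
  by apply: sepA => // b /sepa/eqP.
have [x neqx] : exists x, (x \in F b) != (x \in F a).
  apply/existsP; apply: contraTT Bb; rewrite negb_exists => /forallP eqFx.
  suff -> : b = a by rewrite setD11.
  by apply/injF/setP => x; apply/eqP; rewrite -[_ == _]negbK.
(* Since [b] lies in [A :\ a], the predecessor in [leC] is not truncated and leaves room for [x]. *)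
have leC1 : #|x |: C| <= #|A :\ a|.
  have B_gt0 : 0 < #|A :\ a| by apply/card_gt0P; exists b.
  by rewrite cardsU1 -(prednK B_gt0) -add1n leq_add // leq_b1.
exists (x |: C); first by rewrite cardA.
apply: sepA => [|c Bc eqca]; first exact: subsetUr.
(* A collision of [c] with [a] on [x |: C] restricts to [C], where [b] already collides with [a];
   but [x] tells [b] from [a]. *)
have cb : c = b.
  by apply: injC => //; rewrite eqba; apply: trace_eqS eqca; apply: subsetUr.
case/eqP: neqx; rewrite -cb.
by have /setP/(_ x) := eqca; rewrite !inE eqxx !andbT.
Qed.

Lemma OD_code_setC1 (G : sgraph) (C : {set G}) (w : G) :
  (forall v : G, ~~ isolated v) -> w \notin C ->
  injective (fun v : G => open_nbh v :&: C) -> OD_code (~: [set w]).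
Proof.
move=> hiso wC injC; apply/andP; split.
  (* Each vertex other than [w] dominates itself; a neighbour of [w] differs from [w] and dominates
     it. *)
  apply/forallP => v; apply/set0Pn; have [->|nvw] := eqVneq v w; last first.
    by exists v; rewrite !inE eqxx.
  have /set0Pn[u] := hiso w; rewrite inE => uw; exists u.
  by rewrite !inE uw orbT; apply: contraTneq uw => ->; rewrite adj_irr.
apply/forallP => u; apply/forallP => v; apply/implyP; apply: contra_neq.
move=> equv; apply: injC; apply: trace_eqS equv.
by apply/subsetP => x Cx; rewrite !inE; apply: contraTneq Cx => ->.
Qed.

Lemma OD_code_card (G : sgraph) (C : {set G}) : OD_code C -> #|G| <= 2 ^ #|C|.
Proof.
case/andP=> _ /forallP sepC; rewrite -card_powerset.
have injC : injective (fun v : G => open_nbh v :&: C).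
  move=> u v equv; apply/eqP.
  by apply: contra_eqT equv => neq; exact: (implyP (forallP (sepC u) v)).
rewrite -(card_codom injC); apply/subset_leq_card/subsetP => _ /codomP[v ->].
by rewrite inE subsetIr.
Qed.

Theorem theorem2 (G : sgraph) (n : nat)
  (hcard : #|G| = n) (hn : 2 <= n)
  (htwins : forall u v : G, ~~ open_twins u v)
  (hiso : forall v : G, ~~ isolated v) :
  up_log 2 n <= OD_number G /\ OD_number G <= n - 1.
Proof.
have injN : injective (@open_nbh G).
  move=> u v /eqP equv; apply/eqP; have := htwins u v.
  by rewrite /open_twins equv andbT negbK.
have [C leC injC] := separating_points _ _ _ [set: G] injN.
have [w wC] : exists w, w \notin C.
  apply/existsP; rewrite -negb_forall; apply: contraL leC => /forallP allC.
  have -> : C = setT by apply/setP => x; rewrite inE allC.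
  by rewrite cardsT hcard -ltnNge prednK // ltnW.
have odw : OD_code (~: [set w]).
  by apply: OD_code_setC1 hiso wC _ => u v; apply: injC; rewrite inE.
(* The code [~: [set w]] makes [OD_number] a true minimum, attained at [D], rather than its default
   value. *)
have [[D odD cardD] minD] := OD_numberP odw; split.
  by rewrite -cardD up_log_min // -hcard OD_code_card.
by rewrite subn1 -hcard -(cardsC1 w) minD.
Qed.
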